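(* Let $A\in\mathbb{R}^{m\times n}$ and $b\in\mathbb{R}^m$. For any probability spaces $(\Omega,\mathcal F,P)$ and $(\overline\Omega,\overline{\mathcal F},\overline P)$ of sampling matrices $S$ and $T$, respectively, one has $$\mathcal X_{\Phi}=\mathcal X_{g,f}=\mathcal X_{\Psi}.$$
   Context: $(\Omega,\mathcal F,P)$ is a probability space whose elements $S\in\Omega$ are real matrices with $m$ rows; $(\overline\Omega,\overline{\mathcal F},\overline P)$ is a probability space whose elements $T\in\overline\Omega$ are real matrices with $n$ rows. The expectations below are assumed to exist and be finite. For $x\in\mathbb R^n$, $z\in\mathbb R^m$ define $$g_T(z)=\tfrac12\|T^\top A^\top z\|_2^2,\qquad f_S(x,z)=\tfrac12\|S^\top(Ax-(b-z))\|_2^2,$$ $$g(z)=\mathbb E_{T\in\overline\Omega}[g_T(z)],\qquad f(x,z)=\mathbb E_{S\in\Omega}[f_S(x,z)],$$ $$\Phi_{S,T}(x,z)=g_T(z)+f_S(x,z),\qquad \Phi(x,z)=\mathbb E[\Phi_{S,T}(x,z)],\qquad \Psi(x,z)=(g(z),f(x,z))\in\mathbb R^2.$$ - $\mathcal X_\Phi$ is the set of minimizers of the unconstrained stochastic optimization problem $\min_{(x,z)\in\mathbb R^n\times\mathbb R^m}\Phi(x,z)$. - $\mathcal X_{g,f}$ is the solution set of the constrained stochastic problem: find $(x,z)\in\mathbb R^n\times\mathbb R^m$ subject to $g(z)=0$ and $f(x,z)=0$. - $\mathcal X_\Psi$ is the set of minimizers of the multiobjective problem $\min_{(x,z)\in\mathbb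 R^n\times\mathbb R^m}\Psi(x,z)$, i.e. the points $(x,z)$ at which both objective functions $(x,z)\mapsto g(z)$ and $(x,z)\mapsto f(x,z)$ simultaneously attain their minimum over $\mathbb R^n\times\mathbb R^m$. *)

(* Defs.v *)
From mathcomp Require Import all_boot all_order all_algebra.
From mathcomp Require Import all_classical all_reals all_analysis.

Set Implicit Arguments.
Unset Strict Implicit.
Unset Printing Implicit Defensive.

Import Order.TTheory GRing.Theory Num.Theory.

Local Open Scope classical_set_scope.
Local Open Scope ring_scope.

(* The library norm on matrices is the sup norm, hence this definition. *)
Definition norm2 (R : realType) (k : nat) (v : 'cV[R]_k) : R :=
  Num.sqrt (\sum_(i < k) v i 0 ^+ 2).

(* Real matrices with p rows and an arbitrary number of columns, which may
   differ from one matrix to another. *)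
Definition sampling_matrix (R : realType) (p : nat) : Type :=
  {k : nat & 'M[R]_(p, k)}.

Definition minimizers (R : realType) (V : Type) (F : V -> R) : set V :=
  [set v | forall w, F v <= F w].

Definition gT (R : realType) (m n : nat) (A : 'M[R]_(m, n))
    (T : sampling_matrix R n) (z : 'cV[R]_m) : R :=
  2^-1 * norm2 ((projT2 T)^T *m A^T *m z) ^+ 2.

Definition fS (R : realType) (m n : nat) (A : 'M[R]_(m, n)) (b : 'cV[R]_m)
    (S : sampling_matrix R m) (x : 'cV[R]_n) (z : 'cV[R]_m) : R :=
  2^-1 * norm2 ((projT2 S)^T *m (A *m x - (b - z))) ^+ 2.

Definition PhiST (R : realType) (m n : nat) (A : 'M[R]_(m, n)) (b : 'cV[R]_m)
    (S : sampling_matrix R m) (T : sampling_matrix R n)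
    (x : 'cV[R]_n) (z : 'cV[R]_m) : R :=
  gT A T z + fS A b S x z.

(* Below, a probability space of matrices is a probability space Omega with a
   map sending each point of Omega to the matrix it stands for. The library
   expectation takes values in \bar R; [fine] sends infinite values to 0, so
   these real-valued functions are meaningful only under integrability. *)

Definition g (R : realType) (m n : nat) (A : 'M[R]_(m, n))
    (d : measure_display) (Omegabar : measurableType d)
    (Pbar : probability Omegabar R) (T : Omegabar -> sampling_matrix R n)
    (z : 'cV[R]_m) : R :=
  fine ('E_Pbar[fun t => gT A (T t) z])%E.

Definition f (R : realType) (m n : nat) (A : 'M[R]_(m, n)) (b : 'cV[R]_m)
    (d : measure_display) (Omega : measurableType d)
    (P : probability Omega R) (S : Omega -> sampling_matrix R m)
    (x : 'cV[R]_n) (z : 'cV[R]_m) : R :=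
  fine ('E_P[fun s => fS A b (S s) x z])%E.

(* Q is a joint law of (S, T): its marginals are P and Pbar. The product
   measure (S and T independent) is the basic example. *)
Definition joint_law (R : realType) (d d' : measure_display)
    (Omega : measurableType d) (Omegabar : measurableType d')
    (P : probability Omega R) (Pbar : probability Omegabar R)
    (Q : probability (Omega * Omegabar)%type R) : Prop :=
  (forall B : set Omega, measurable B -> Q (B `*` setT) = P B) /\
  (forall C : set Omegabar, measurable C -> Q (setT `*` C) = Pbar C).

Definition Phi (R : realType) (m n : nat) (A : 'M[R]_(m, n)) (b : 'cV[R]_m)
    (d d' : measure_display)
    (Omega : measurableType d) (Omegabar : measurableType d')
    (Q : probability (Omega * Omegabar)%type R)
    (S : Omega -> sampling_matrix R m) (T : Omegabar -> sampling_matrix R n)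
    (x : 'cV[R]_n) (z : 'cV[R]_m) : R :=
  fine ('E_Q[fun w => PhiST A b (S w.1) (T w.2) x z])%E.

Definition Psi (R : realType) (m n : nat) (A : 'M[R]_(m, n)) (b : 'cV[R]_m)
    (d d' : measure_display)
    (Omega : measurableType d) (Omegabar : measurableType d')
    (P : probability Omega R) (Pbar : probability Omegabar R)
    (S : Omega -> sampling_matrix R m) (T : Omegabar -> sampling_matrix R n)
    (x : 'cV[R]_n) (z : 'cV[R]_m) : R * R :=
  (g A Pbar T z, f A b P S x z).

Definition X_Phi (R : realType) (m n : nat) (A : 'M[R]_(m, n)) (b : 'cV[R]_m)
    (d d' : measure_display)
    (Omega : measurableType d) (Omegabar : measurableType d')
    (Q : probability (Omega * Omegabar)%type R)
    (S : Omega -> sampling_matrix R m) (T : Omegabar -> sampling_matrix R n) :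
    set ('cV[R]_n * 'cV[R]_m) :=
  minimizers (fun u => Phi A b Q S T u.1 u.2).

Definition X_gf (R : realType) (m n : nat) (A : 'M[R]_(m, n)) (b : 'cV[R]_m)
    (d d' : measure_display)
    (Omega : measurableType d) (Omegabar : measurableType d')
    (P : probability Omega R) (Pbar : probability Omegabar R)
    (S : Omega -> sampling_matrix R m) (T : Omegabar -> sampling_matrix R n) :
    set ('cV[R]_n * 'cV[R]_m) :=
  [set u | g A Pbar T u.2 = 0 /\ f A b P S u.1 u.2 = 0].

Definition X_Psi (R : realType) (m n : nat) (A : 'M[R]_(m, n)) (b : 'cV[R]_m)
    (d d' : measure_display)
    (Omega : measurableType d) (Omegabar : measurableType d')
    (P : probability Omega R) (Pbar : probability Omegabar R)
    (S : Omega -> sampling_matrix R m) (T : Omegabar -> sampling_matrix R n) :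
    set ('cV[R]_n * 'cV[R]_m) :=
  minimizers (fun u => (Psi A b P Pbar S T u.1 u.2).1) `&`
  minimizers (fun u => (Psi A b P Pbar S T u.1 u.2).2).

Lemma joint_law_product (R : realType) (d d' : measure_display)
    (Omega : measurableType d) (Omegabar : measurableType d')
    (P : probability Omega R) (Pbar : probability Omegabar R) :
  joint_law P Pbar (P \x Pbar)%E.
Proof.
split=> [B mB|C mC].
- apply: (etrans (product_measure1E P Pbar mB measurableT)).
  exact: etrans (congr1 (mule _) (probability_setT Pbar)) (mule1 _).
- apply: (etrans (product_measure1E P Pbar measurableT mC)).
  exact: etrans (congr1 (mule^~ _) (probability_setT P)) (mul1e _).
Qed.

(* Main.v *)
Require Import Defs.
From mathcomp Require Import all_boot all_order all_algebra.
From mathcomp Require Import all_classical all_reals all_analysis.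
From mathcomp Require Import measurable_realfun.

(** The functions [g] and [f] are nonnegative, being expectations of squared
    norms, and they vanish together somewhere ([normal_equations_solvable]): if
    x solves the normal equations A^T A x = A^T b, then the residual
    z = b - A x satisfies A^T z = 0 and A x = b - z, so that every sampled
    g_T(z) and f_S(x,z) is zero, whatever T and S are.  Hence the minimum of g
    and the minimum of f are both 0.  For nonnegative functions with a common
    zero, minimizing the sum, being a common zero, and minimizing both functions
    at once are the same thing ([minimizers_add], [minimizers_ge0]).

    What remains is that Phi is the sum of g and f
    ([Phi_sum]).  A joint law Q of (S, T) may correlate S and T, but g_T depends
    on T alone and f_S on S alone; the expectation of each term is determined by
    the corresponding marginal of Q, by the change of variables formula along
    the projections ([ge0_integral_marginal]). *)

Import Order.TTheory GRing.Theory Num.Theory.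

Local Open Scope classical_set_scope.
Local Open Scope ring_scope.

Lemma minimizers_ge0 {R : realType} {V : Type} (F : V -> R) (v0 : V) :
  (forall v, 0 <= F v) -> F v0 = 0 -> minimizers F = [set v | F v = 0].
Proof.
move=> F0 Fv0; apply/seteqP; split=> v /= => [minv|Fv w]; last by rewrite Fv.
by apply/le_anti; rewrite F0 -Fv0 minv.
Qed.

Lemma minimizers_add {R : realType} {V : Type} (F G : V -> R) (v0 : V) :
  (forall v, 0 <= F v) -> (forall v, 0 <= G v) -> F v0 = 0 -> G v0 = 0 ->
  minimizers (fun v => F v + G v) = [set v | F v = 0 /\ G v = 0].
Proof.
move=> F0 G0 Fv0 Gv0; rewrite (minimizers_ge0 _ v0); first last.
- by rewrite Fv0 Gv0 addr0.
- by move=> v; rewrite addr_ge0.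
apply/seteqP; split=> v /= => [/eqP|[-> ->]]; last by rewrite addr0.
by rewrite paddr_eq0// => /andP[/eqP ? /eqP ?].
Qed.

(** The diagonal entries of M^T M are the sums of squares of the columns. *)
Lemma gram_eq0 {R : realDomainType} {p q : nat} (M : 'M[R]_(p, q)) :
  M^T *m M = 0 -> M = 0.
Proof.
move=> MM0; apply/matrixP => i j; move/matrixP/(_ j j): MM0.
rewrite !mxE => /eqP; rewrite psumr_eq0 => [/allP/(_ i)|k _]; last first.
  by rewrite mxE -expr2 sqr_ge0.
by rewrite mem_index_enum mxE -expr2 sqrf_eq0 => /(_ isT)/eqP.
Qed.

(** In terms of row spaces, x exists when b^T A lies in the row space of A^T A,
    that is, when b^T A annihilates the cokernel K of A^T A.  This holds because
    A K itself is zero: its Gram matrix is K^T (A^T A K) = 0. *)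
Lemma normal_equations_solvable {R : realFieldType} {m n : nat}
    (A : 'M[R]_(m, n)) (b : 'cV[R]_m) :
  exists x : 'cV[R]_n, A^T *m (b - A *m x) = 0.
Proof.
pose K := cokermx (A^T *m A).
have AK0 : A *m K = 0.
  by apply: gram_eq0; rewrite trmx_mul -mulmxA (mulmxA A^T) mulmx_coker mulmx0.
have /submxP[y yE] : (b^T *m A <= A^T *m A)%MS.
  by rewrite submxE -mulmxA -/K AK0 mulmx0.
exists y^T; apply/eqP; rewrite mulmxBr mulmxA subr_eq0; apply/eqP/trmx_inj.
by rewrite !trmx_mul !trmxK.
Qed.

(** Change of variables, where nu is the image of mu under phi. *)
Lemma ge0_integral_marginal {R : realType} {d1 d2 : measure_display}
    {X : measurableType d1} {Y : measurableType d2}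
    (mu : {measure set X -> \bar R}) (nu : {measure set Y -> \bar R})
    (phi : X -> Y) (h : Y -> \bar R) :
  measurable_fun setT phi ->
  (forall B, measurable B -> mu (phi @^-1` B) = nu B) ->
  measurable_fun setT h -> (forall y, 0 <= h y)%E ->
  (\int[mu]_x h (phi x) = \int[nu]_y h y)%E.
Proof.
move=> mphi munu mh h0.
rewrite -[LHS](ge0_integral_pushforward mphi mu measurableT mh)//.
by apply: eq_measure_integral => B mB _; exact: munu.
Qed.

Lemma norm20 {R : realType} (k : nat) : norm2 (0 : 'cV[R]_k) = 0.
Proof.
by rewrite /norm2 big1 ?sqrtr0// => i _; rewrite mxE expr0n.
Qed.

Lemma gT_ge0 {R : realType} {m n : nat} (A : 'M[R]_(m, n))
    (T : sampling_matrix R n) (z : 'cV[R]_m) : 0 <= gT A T z.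
Proof. by rewrite mulr_ge0 ?invr_ge0 ?sqr_ge0. Qed.

Lemma fS_ge0 {R : realType} {m n : nat} (A : 'M[R]_(m, n)) (b : 'cV[R]_m)
    (S : sampling_matrix R m) (x : 'cV[R]_n) (z : 'cV[R]_m) :
  0 <= fS A b S x z.
Proof. by rewrite mulr_ge0 ?invr_ge0 ?sqr_ge0. Qed.

Lemma gT_eq0 {R : realType} {m n : nat} (A : 'M[R]_(m, n))
    (T : sampling_matrix R n) (z : 'cV[R]_m) : A^T *m z = 0 -> gT A T z = 0.
Proof. by rewrite /gT -mulmxA => ->; rewrite mulmx0 norm20 expr0n mulr0. Qed.

Lemma fS_eq0 {R : realType} {m n : nat} (A : 'M[R]_(m, n)) (b : 'cV[R]_m)
    (S : sampling_matrix R m) (x : 'cV[R]_n) : fS A b S x (b - A *m x) = 0.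
Proof. by rewrite /fS subKr subrr mulmx0 norm20 expr0n mulr0. Qed.

Lemma g_ge0 {R : realType} {m n : nat} (A : 'M[R]_(m, n))
    {d : measure_display} {Omegabar : measurableType d}
    (Pbar : probability Omegabar R) (T : Omegabar -> sampling_matrix R n)
    (z : 'cV[R]_m) : 0 <= g A Pbar T z.
Proof. by rewrite fine_ge0// expectation_ge0// => t; exact: gT_ge0. Qed.

Lemma f_ge0 {R : realType} {m n : nat} (A : 'M[R]_(m, n)) (b : 'cV[R]_m)
    {d : measure_display} {Omega : measurableType d}
    (P : probability Omega R) (S : Omega -> sampling_matrix R m)
    (x : 'cV[R]_n) (z : 'cV[R]_m) : 0 <= f A b P S x z.
Proof. by rewrite fine_ge0// expectation_ge0// => s; exact: fS_ge0. Qed.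

Lemma exists_common_zero {R : realType} {m n : nat}
    (A : 'M[R]_(m, n)) (b : 'cV[R]_m) {d d' : measure_display}
    {Omega : measurableType d} {Omegabar : measurableType d'}
    (P : probability Omega R) (Pbar : probability Omegabar R)
    (S : Omega -> sampling_matrix R m) (T : Omegabar -> sampling_matrix R n) :
  exists x z, g A Pbar T z = 0 /\ f A b P S x z = 0.
Proof.
have [x Ax] := normal_equations_solvable A b.
exists x, (b - A *m x); rewrite /g /f unlock; split.
- by rewrite integral0_eq// => t _; rewrite gT_eq0.
- by rewrite integral0_eq// => s _; rewrite fS_eq0.
Qed.

Lemma Phi_sum {R : realType} {m n : nat}
    (A : 'M[R]_(m, n)) (b : 'cV[R]_m) {d d' : measure_display}
    {Omega : measurableType d} {Omegabar : measurableType d'}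
    (P : probability Omega R) (Pbar : probability Omegabar R)
    (S : Omega -> sampling_matrix R m) (T : Omegabar -> sampling_matrix R n)
    (Q : probability (Omega * Omegabar)%type R)
    (x : 'cV[R]_n) (z : 'cV[R]_m) :
  joint_law P Pbar Q ->
  Pbar.-integrable setT (EFin \o (fun t => gT A (T t) z)) ->
  P.-integrable setT (EFin \o (fun s => fS A b (S s) x z)) ->
  Phi A b Q S T x z = g A Pbar T z + f A b P S x z.
Proof.
move=> [Q1 Q2] intg intf.
have mg := measurable_int _ intg; have mf := measurable_int _ intf.
have gT0 t : (0 <= (EFin \o (fun t => gT A (T t) z)) t)%E.
  by rewrite lee_fin gT_ge0.
have fS0 s : (0 <= (EFin \o (fun s => fS A b (S s) x z)) s)%E.
  by rewrite lee_fin fS_ge0.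
rewrite /Phi /g /f unlock -fineD; try exact: integrable_fin_num.
congr fine; rewrite -(ge0_integral_marginal Q Pbar snd _ _ _ mg gT0)//; last first.
  by move=> B mB; rewrite -setTX; exact: Q2.
rewrite -(ge0_integral_marginal Q P fst _ _ _ mf fS0)//; last first.
  by move=> B mB; rewrite -setXT; exact: Q1.
rewrite -ge0_integralD//.
- exact: measurableT_comp mg _.
- exact: measurableT_comp mf _.
Qed.

Theorem theorem2p1 (R : realType) (m n : nat)
    (A : 'M[R]_(m, n)) (b : 'cV[R]_m)
    (d d' : measure_display)
    (Omega : measurableType d) (Omegabar : measurableType d')
    (P : probability Omega R) (Pbar : probability Omegabar R)
    (S : Omega -> sampling_matrix R m) (T : Omegabar -> sampling_matrix R n)
    (Q : probability (Omega * Omegabar)%type R)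
    (PQ : joint_law P Pbar Q)
    (intg : forall z : 'cV[R]_m,
      Pbar.-integrable setT (EFin \o (fun t => gT A (T t) z)))
    (intf : forall (x : 'cV[R]_n) (z : 'cV[R]_m),
      P.-integrable setT (EFin \o (fun s => fS A b (S s) x z))) :
  X_Phi A b Q S T = X_gf A b P Pbar S T /\
  X_gf A b P Pbar S T = X_Psi A b P Pbar S T.
Proof.
have [x0 [z0 [gz0 fxz0]]] := exists_common_zero A b P Pbar S T.
have g0 (u : 'cV[R]_n * 'cV[R]_m) : 0 <= g A Pbar T u.2 by exact: g_ge0.
have f0 (u : 'cV[R]_n * 'cV[R]_m) : 0 <= f A b P S u.1 u.2 by exact: f_ge0.
split; last by rewrite /X_Psi !(minimizers_ge0 _ (x0, z0)).
rewrite /X_gf -(minimizers_add _ _ (x0, z0) g0 f0)//; congr minimizers.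
by apply/funext => u; exact: Phi_sum.
Qed.
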